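(* Let $f,g_1,\dots,g_m\in\mathbb{R}[x_1,\dots,x_n]$ and $K=\{\mathbf{x}\in\mathbb{R}^n : g_j(\mathbf{x})\ge 0,\ j=1,\dots,m\}$. Assume that $K$ is nonempty and compact, that $0\le g_j(\mathbf{x})\le 1$ for all $\mathbf{x}\in K$ and all $j$, and that the family $\{g_1,\dots,g_m,1-g_1,\dots,1-g_m\}$ generates the $\mathbb{R}$-algebra $\mathbb{R}[x_1,\dots,x_n]$. Let $f_K^\star=\inf_{\mathbf{x}\in K}f(\mathbf{x})$ and let $\mathcal{A}\subseteq\mathbb{N}^n$ be a finite set. For $k,d\in\mathbb{N}$ define $$p_{d,\mathcal{A}}^k=\sup\Big\{t\in\mathbb{R} : L_d(\mathbf{x},\boldsymbol\lambda)-t\in(\Sigma+C)_{n,2k}(\mathcal{A})\ \text{for some}\ \boldsymbol\lambda\ge 0\Big\}.$$ Then for every fixed $k\in\mathbb{N}$, the sequence $\{p_{d,\mathcal{A}}^k\}_{d\in\mathbb{N}}$ is monotonically increasing (i.e. nondecreasing in $d$) and $p_{d,\mathcal{A}}^k\uparrow f_K^\star$ as $d\to\infty$.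
   Context: Notation: $\mathbb{R}[\mathbf{x}]_{n,2k}$ is the space of real polynomials in $n$ variables of degree at most $2k$; $\mathbb{N}$ contains $0$; $\sup\emptyset=-\infty$; $\mathrm{supp}(h)$ is the set of exponents of monomials with nonzero coefficient in $h$. Lagrange polynomial: for $d\in\mathbb{N}$ let $\mathbb{N}^{2m}_d=\{(\mathbf{a},\mathbf{b})\in\mathbb{N}^m\times\mathbb{N}^m : |\mathbf{a}|+|\mathbf{b}|\le d\}$, with $|\mathbf{a}|=\sum_j a_j$. For a vector $\boldsymbol\lambda=(\lambda_{\mathbf{a}\mathbf{b}})_{(\mathbf{a},\mathbf{b})\in\mathbb{N}^{2m}_d}$ of nonnegative reals, $$L_d(\mathbf{x},\boldsymbol\lambda)=f(\mathbf{x})-\sum_{(\mathbf{a},\mathbf{b})\in\mathbb{N}_d^{2m}}\lambda_{\mathbf{a}\mathbf{b}}\prod_{j=1}^m g_j(\mathbf{x})^{a_j}(1-g_j(\mathbf{x}))^{b_j}.$$ SOS cone: $\Sigma_{n,2k}$ is the set of finite sums of squares of polynomials of degree at most $k$ in $n$ variables. SONC cone: A circuit $(S,\boldsymbol\beta)$ consists of a finite affinely independent set $S\subseteq\mathbb{N}^n$ and a point $\boldsymbol\beta\in\mathbb{N}^n\setminus S$ in the relative interior of $\mathrm{conv}(S)$. A monomial square is a term $c\,\mathbf{x}^{\boldsymbol\alpha}$ with $c\ge0$ and $\boldsymbol\alpha\in 2\mathbb{N}^n$. A circuit polynomial is a polynomial that is either a sum of monomial squares or of the form $\sum_{\boldsymbol\alpha\in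 S}c_{\boldsymbol\alpha}\mathbf{x}^{\boldsymbol\alpha}+\delta\,\mathbf{x}^{\boldsymbol\beta}$ with $(S,\boldsymbol\beta)$ a circuit, $S\subseteq 2\mathbb{N}^n$, all $c_{\boldsymbol\alpha}>0$ and $\delta\in\mathbb{R}$. A polynomial is SONC if it is a finite conic combination of circuit polynomials that are nonnegative on $\mathbb{R}^n$. $C_{n,2k}$ is the cone of all SONC polynomials in $\mathbb{R}[\mathbf{x}]_{n,2k}$. SOS+SONC cone: $(\Sigma+C)_{n,2k}=\Sigma_{n,2k}+C_{n,2k}$, and $(\Sigma+C)_{n,2k}(\mathcal{A})=\{h\in(\Sigma+C)_{n,2k} : \mathrm{supp}(h)\subseteq\mathcal{A}\}$. *)

(* Defs.v *)
From HB Require Import structures.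
From mathcomp Require Import all_boot all_order all_algebra.
(* multinomials must be loaded before MathComp-Analysis: the opposite order
   fails on incompatible notation levels. *)
From mathcomp Require Import finmap mpoly.
From mathcomp Require Import boolp classical_sets functions cardinality reals.
From mathcomp Require Import ereal topology normedtype sequences.

Set Implicit Arguments.
Unset Strict Implicit.
Unset Printing Implicit Defensive.

Import Order.TTheory GRing.Theory Num.Theory.
Import numFieldTopology.Exports numFieldNormedType.Exports.

Local Open Scope fset_scope.
Local Open Scope classical_set_scope.
Local Open Scope ring_scope.

Definition evalv (R : realType) (n : nat) (p : {mpoly R[n]}) (x : 'rV[R]_n) : R :=
  p.@[fun i => x ord0 i].

Definition semialg (R : realType) (n m : nat) (g : 'I_m -> {mpoly R[n]}) :
    set 'rV[R]_n :=
  [set x | forall j, 0 <= evalv (g j) x].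

Definition generates_algebra (R : nzRingType) (B : algType R) (G : set B) : Prop :=
  forall S : {pred B}, GRing.subalg_closed S ->
    (forall b, G b -> b \in S) -> forall b, b \in S.

Definition lagrange (R : realType) (n m : nat) (f : {mpoly R[n]})
    (g : 'I_m -> {mpoly R[n]}) (d : nat)
    (lambda : 'X_{1..m} -> 'X_{1..m} -> R) : {mpoly R[n]} :=
  f - \sum_(ab : 'X_{1..m < d.+1} * 'X_{1..m < d.+1}
             | (mdeg ab.1 + mdeg ab.2 <= d)%N)
        lambda ab.1 ab.2 *:
          \prod_(j < m) (g j ^+ (ab.1 : 'X_{1..m}) j
                         * (1 - g j) ^+ (ab.2 : 'X_{1..m}) j).

(* [msize p] is one more than the total degree of [p], and [msize 0 = 0]. *)
Definition deg_le (R : realType) (n e : nat) (p : {mpoly R[n]}) : Prop :=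
  (msize p <= e.+1)%N.

Definition sos_cone (R : realType) (n k : nat) : set {mpoly R[n]} :=
  [set h | exists s : seq {mpoly R[n]},
     (forall q, q \in s -> deg_le k q) /\ h = \sum_(q <- s) q ^+ 2].

Definition even_mnm (n : nat) (a : 'X_{1..n}) : Prop := forall i, ~~ odd (a i).

Definition vec_mnm (R : realType) (n : nat) (a : 'X_{1..n}) : 'rV[R]_n :=
  \row_i (a i)%:R.

Definition affinely_independent (R : realType) (n : nat)
    (S : {fset 'X_{1..n}}) : Prop :=
  forall c : 'X_{1..n} -> R,
    \sum_(a <- S) c a = 0 -> \sum_(a <- S) c a *: vec_mnm R a = 0 ->
    forall a, a \in S -> c a = 0.

Definition affine_hull (R : realType) (n : nat) (C : set 'rV[R]_n) :
    set 'rV[R]_n :=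
  [set x | exists (l : nat) (v : 'I_l -> 'rV[R]_n) (w : 'I_l -> R),
     [/\ forall i, C (v i), \sum_i w i = 1 & x = \sum_i w i *: v i]].

Definition convex_hull (R : realType) (n : nat) (C : set 'rV[R]_n) :
    set 'rV[R]_n :=
  [set x | exists (l : nat) (v : 'I_l -> 'rV[R]_n) (w : 'I_l -> R),
     [/\ forall i, C (v i), forall i, 0 <= w i, \sum_i w i = 1
       & x = \sum_i w i *: v i]].

(* Interior of [C] in the subspace topology of its affine hull. *)
Definition relative_interior (R : realType) (n : nat) (C : set 'rV[R]_n) :
    set 'rV[R]_n :=
  [set x | C x /\ \forall y \near x, affine_hull C y -> C y].

Definition circuit (R : realType) (n : nat) (S : {fset 'X_{1..n}})
    (b : 'X_{1..n}) : Prop :=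
  [/\ affinely_independent R S, b \notin S
    & relative_interior (convex_hull [set vec_mnm R a | a in [set` S]])
        (vec_mnm R b)].

Definition sum_monomial_squares (R : realType) (n : nat) (p : {mpoly R[n]}) : Prop :=
  exists s : seq (R * 'X_{1..n}),
    (forall t, t \in s -> 0 <= t.1 /\ even_mnm t.2) /\
    p = \sum_(t <- s) t.1 *: 'X_[t.2].

Definition circuit_polynomial (R : realType) (n : nat) (p : {mpoly R[n]}) : Prop :=
  sum_monomial_squares p \/
  exists (S : {fset 'X_{1..n}}) (b : 'X_{1..n}) (c : 'X_{1..n} -> R) (delta : R),
    [/\ circuit R S b,
        forall a, a \in S -> even_mnm a,
        forall a, a \in S -> 0 < c a
      & p = \sum_(a <- S) c a *: 'X_[a] + delta *: 'X_[b]].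

Definition sonc (R : realType) (n : nat) (p : {mpoly R[n]}) : Prop :=
  exists s : seq (R * {mpoly R[n]}),
    (forall t, t \in s ->
       [/\ 0 <= t.1, circuit_polynomial t.2 & forall x, 0 <= evalv t.2 x]) /\
    p = \sum_(t <- s) t.1 *: t.2.

Definition sonc_cone (R : realType) (n k : nat) : set {mpoly R[n]} :=
  [set h | sonc h /\ deg_le (2 * k) h].

Definition sos_sonc_cone (R : realType) (n k : nat) : set {mpoly R[n]} :=
  [set h | exists s c, [/\ sos_cone k s, sonc_cone k c & h = s + c]].

Definition sos_sonc_cone_supp (R : realType) (n k : nat)
    (A : {fset 'X_{1..n}}) : set {mpoly R[n]} :=
  [set h | sos_sonc_cone k h /\ {subset msupp h <= A}].

(* Both bounds live in the extended reals, where [ereal_sup set0 = -oo]. *)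
Definition lagrange_bound (R : realType) (n m : nat) (f : {mpoly R[n]})
    (g : 'I_m -> {mpoly R[n]}) (A : {fset 'X_{1..n}}) (k d : nat) : \bar R :=
  ereal_sup [set t%:E | t in
    [set t : R | exists lambda : 'X_{1..m} -> 'X_{1..m} -> R,
       (forall a b, (mdeg a + mdeg b <= d)%N -> 0 <= lambda a b) /\
       sos_sonc_cone_supp k A (lagrange f g d lambda - t%:MP)]].

Definition min_value (R : realType) (n : nat) (f : {mpoly R[n]})
    (K : set 'rV[R]_n) : \bar R :=
  ereal_inf [set (evalv f x)%:E | x in K].

(* Main.v *)
Require Import Defs.
From HB Require Import structures.
From mathcomp Require Import all_boot all_order all_algebra.
From mathcomp Require Import finmap mpoly.
From mathcomp Require Import boolp classical_sets functions cardinality reals.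
From mathcomp Require Import ereal topology normedtype sequences.
From mathcomp Require Import derive ring lra zify.
Import Order.TTheory GRing.Theory Num.Theory.
Import numFieldTopology.Exports numFieldNormedType.Exports.
Local Open Scope classical_set_scope.
Local Open Scope ring_scope.

(** Write K for the set where all [g j] are nonnegative, and call box cone of
    degree d the set of nonnegative combinations of the products
    g^a (1 - g)^b with |a| + |b| <= d.  The Lagrange polynomials of order d are
    exactly f - p with p in this cone.

    Upper bound.  Sums of squares and SONC polynomials are nonnegative
    everywhere, and p is nonnegative on K because 0 <= g j <= 1 there.  So if
    f - p - t lies in the SOS+SONC cone then t <= f on K
    ([lagrange_bound_le_min]).  The bounds grow with d since the box cones do
    ([box_cone_le]).

    Lower bound.  For t < inf_K f, the polynomial f - t is positive on K and
    therefore lies in some box cone ([box_cone_pos_semialg], a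
    Positivstellensatz of Krivine type).  With p = f - t the polynomial
    f - p - t is 0, which belongs to the SOS+SONC cone whatever k and the
    support set A are; hence the bound of order d is at least t.

    The Positivstellensatz is deduced from the case of the unit cube.  Since
    the [g j] generate the algebra, a polynomial P that is positive on K can be
    written P = F(g) with F in m variables, and likewise 'X_i = h_i(g).  The polynomial
    q(y) = sum_j (y_j - g_j(h(y)))^2 satisfies q(g) = 0, and its zeros in the
    cube are the points g(x) with x in K, where F(g(x)) = P(x) > 0.  By
    compactness of the cube, F + c q is positive on the cube for some c
    ([compact_penalty]); substituting g for y turns any representation of
    F + c q over the cube into one of P.

    On the cube itself ([box_cone_pos_cube]) one expands a polynomial in the
    tensor Bernstein basis of degree N in each variable
    ([bernstein_expansion]).  Its coefficients differ from the values of the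
    polynomial at the grid points k / N by O(1 / N)
    ([bernstein_coef_approx]), so they are all positive for large N when the
    polynomial is positive on the cube. *)

Set Implicit Arguments.
Unset Strict Implicit.

(** * The Bernstein basis in one variable *)

(** Both sides count the pairs A included in B of subsets of an N-element set
    with #|A| = a and #|B| = k; the proof compares factorials. *)
Lemma mul_bin_nested (N k a : nat) : (a <= k)%N -> (k <= N)%N ->
  ('C(k, a) * 'C(N, k) = 'C(N, a) * 'C(N - a, k - a))%N.
Proof.
move=> ak kN.
have aN := leq_trans ak kN.
have pos : (0 < a`! * (k - a)`! * (N - k)`!)%N by rewrite !muln_gt0 !fact_gt0.
apply/eqP; rewrite -(eqn_pmul2r pos); apply/eqP.
have e1 := bin_fact ak; have e2 := bin_fact kN; have e3 := bin_fact aN.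
have e4 : ('C(N - a, k - a) * ((k - a)`! * (N - k)`!) = (N - a)`!)%N.
  have <- : (N - a - (k - a) = N - k)%N by rewrite subnBA // subnK.
  by rewrite bin_fact // leq_sub2r.
transitivity (N`!); first by rewrite -e2 -e1; ring.
by rewrite -e3 -e4; ring.
Qed.

(** Expand u^a * ((1 - u) + u)^(N - a) by the binomial theorem and renormalise
    with [mul_bin_nested]. *)
Lemma bernstein_monomial (R : realFieldType) (B : comAlgType R) (u : B)
    (N a : nat) : (a <= N)%N ->
  u ^+ a = \sum_(k < N.+1) ('C(k, a)%:R / 'C(N, a)%:R * 'C(N, k)%:R) *:
             (u ^+ k * (1 - u) ^+ (N - k)).
Proof.
move=> aN.
rewrite -(big_mkord xpredT (fun k => ('C(k, a)%:R / 'C(N, a)%:R * 'C(N, k)%:R) *: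
             (u ^+ k * (1 - u) ^+ (N - k)))).
rewrite (@big_cat_nat _ _ _ a) //=; last exact: leqW.
rewrite big_nat_cond big1 ?add0r; last first.
  by move=> k /andP[/andP[_ ka] _]; rewrite bin_small // !mul0r scale0r.
rewrite -[X in \sum_(X <= _ < _) _]add0n big_addn big_mkord subSn //.
rewrite -[LHS]mulr1 -[X in _ * X = _](expr1n _ (N - a)).
rewrite -{1}[1](subrK u) exprDn mulr_sumr.
apply: eq_bigr => i _.
have iN : (i <= N - a)%N by rewrite -ltnS.
have iaN : (i + a <= N)%N by lia.
have -> : 'C(i + a, a)%:R / 'C(N, a)%:R * 'C(N, i + a)%:R = 'C(N - a, i)%:R :> R.
  rewrite mulrAC -natrM mul_bin_nested ?leq_addl //= addnK natrM mulrAC mulfV ?mul1r //.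
  by rewrite pnatr_eq0 -lt0n bin_gt0.
rewrite scaler_nat mulrnAr; congr (_ *+ _).
by rewrite mulrA mulrAC -exprD addnC mulrC [RHS]mulrC (addnC i a) subnDA.
Qed.

(** Telescoping: replacing the factors one at a time costs only the difference
    of the factors, the other ones having norm at most 1. *)
Lemma norm_prod_sub_le (R : realFieldType) (I : Type) (r : seq I) (u v : I -> R) :
  (forall i, `|u i| <= 1) -> (forall i, `|v i| <= 1) ->
  `|\prod_(i <- r) u i - \prod_(i <- r) v i| <= \sum_(i <- r) `|u i - v i|.
Proof.
move=> u1 v1; elim: r => [|i r IH]; first by rewrite !big_nil subrr normr0.
rewrite !big_cons.
set U := \prod_(j <- r) u j; set V := \prod_(j <- r) v j.
have -> : u i * U - v i * V = (u i - v i) * V + u i * (U - V) by ring.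
apply: le_trans (ler_normD _ _) _; rewrite !normrM; apply: lerD.
  rewrite ler_piMr // /V; elim/big_ind: _ => [|x y hx hy|j _]; rewrite ?normr1 //.
  by rewrite normrM mulr_ile1.
by apply: le_trans IH; rewrite ler_piMl.
Qed.

Lemma bin_ratioS (R : realFieldType) (N k a : nat) : (a < N)%N -> (k <= N)%N ->
  'C(k, a.+1)%:R / 'C(N, a.+1)%:R =
    'C(k, a)%:R / 'C(N, a)%:R * ((k - a)%:R / (N - a)%:R) :> R.
Proof.
move=> aN kN.
have a1 : a.+1%:R != 0 :> R by rewrite pnatr_eq0.
have e1 : a.+1%:R * 'C(k, a.+1)%:R = (k - a)%:R * 'C(k, a)%:R :> R.
  by rewrite -!natrM mul_bin_left.
have e2 : a.+1%:R * 'C(N, a.+1)%:R = (N - a)%:R * 'C(N, a)%:R :> R.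
  by rewrite -!natrM mul_bin_left.
rewrite mulf_div [_ * (k - a)%:R]mulrC [_ * (N - a)%:R]mulrC -e1 -e2.
by rewrite -mulf_div mulfV // mul1r.
Qed.

Lemma bin_ratio_ge0_le1 (R : realFieldType) (N k a : nat) :
  (k <= N)%N -> 0 <= ('C(k, a)%:R / 'C(N, a)%:R : R) <= 1.
Proof.
move=> kN; rewrite divr_ge0 //=.
have [aN|Na] := leqP a N; last by rewrite [in X in _ / X]bin_small // invr0 mulr0.
by rewrite ler_pdivrMr ?ltr0n ?bin_gt0 // mul1r ler_nat leq_bin2l.
Qed.

(** The ratio is the product of the (k - i) / (N - i) for i < a, and each factor
    is within i / (N - i) <= 2 D / N of k / N.  The bound is uniform in k, which
    is what makes all Bernstein coefficients positive at once. *)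
Lemma bin_ratio_approx (R : realFieldType) (D N k a : nat) :
  (0 < N)%N -> (2 * D <= N)%N -> (a <= D)%N -> (k <= N)%N ->
  `|'C(k, a)%:R / 'C(N, a)%:R - (k%:R / N%:R) ^+ a| <= a%:R * ((2 * D)%:R / N%:R) :> R.
Proof.
move=> N0 DN + kN; elim: a => [|a IH] aD.
  by rewrite !bin0 expr0 divr1 subrr normr0 mul0r.
have aD' := ltnW aD; have {IH}IH := IH aD'.
have aN : (a < N)%N by lia.
rewrite bin_ratioS // exprSr.
set w := _ / _ in IH *; set x := k%:R / N%:R in IH *.
have /andP[w0 w1] : 0 <= w <= 1 by exact: bin_ratio_ge0_le1.
have Npos : 0 < N%:R :> R by rewrite ltr0n.
have x0 : 0 <= x by rewrite divr_ge0.
have x1 : x <= 1 by rewrite ler_pdivrMr // mul1r ler_nat.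
have -> : w * ((k - a)%:R / (N - a)%:R) - x ^+ a * x =
  w * ((k - a)%:R / (N - a)%:R - x) + (w - x ^+ a) * x by ring.
rewrite -natr1 [leRHS]mulrDl mul1r [leRHS]addrC.
apply: le_trans (ler_normD _ _) _.
rewrite (normrM w) (normrM (w - x ^+ a)); apply: lerD; last first.
  by apply: le_trans IH; rewrite ler_piMr // ger0_norm.
(* k - a is truncated when k < a, but then the ratio w vanishes. *)
have [ka|ak] := ltnP k a.
  rewrite /w bin_small // !mul0r normr0 mul0r.
  by rewrite divr_ge0.
apply: (@le_trans _ _ (`|(k - a)%:R / (N - a)%:R - x|)).
  by rewrite ler_piMl // ger0_norm //.
have Na : 0 < (N - a)%:R :> R by rewrite ltr0n subn_gt0.
have -> : (k - a)%:R / (N - a)%:R - x = - (a%:R / (N - a)%:R * ((N - k)%:R / N%:R)).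
  rewrite /x !natrB // ?(ltnW aN) //; field.
  by rewrite -natrB ?(ltnW aN) // !gt_eqF.
rewrite normrN normrM !ger0_norm ?divr_ge0 //.
apply: (@le_trans _ _ (a%:R / (N - a)%:R)).
  rewrite ler_piMr ?divr_ge0 //.
  by rewrite ler_pdivrMr // mul1r ler_nat leq_subr.
rewrite ler_pdivrMr // mulrAC ler_pdivlMr // -!natrM ler_nat.
nia.
Qed.

(** * The cone of box products *)

Definition box_product (R : realType) (n m : nat) (g : 'I_m -> {mpoly R[n]})
    (a b : 'X_{1..m}) : {mpoly R[n]} :=
  \prod_(j < m) (g j ^+ a j * (1 - g j) ^+ b j).

Definition box_cone (R : realType) (n m : nat) (g : 'I_m -> {mpoly R[n]})
    (d : nat) : set {mpoly R[n]} :=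
  [set p | exists lambda : 'X_{1..m} -> 'X_{1..m} -> R,
    (forall a b, (mdeg a + mdeg b <= d)%N -> 0 <= lambda a b) /\
    p = \sum_(ab : 'X_{1..m < d.+1} * 'X_{1..m < d.+1}
                | (mdeg ab.1 + mdeg ab.2 <= d)%N)
          lambda ab.1 ab.2 *: box_product g ab.1 ab.2].

(** All combinations are collected by grouping equal exponents; this is how
    membership in a box cone is established below, the index type of a sum being
    more convenient than the truncated exponents of the definition. *)
Lemma box_cone_sum (R : realType) (n m : nat) (g : 'I_m -> {mpoly R[n]})
    (d : nat) (I : Type) (r : seq I) (P : pred I) (c : I -> R)
    (a b : I -> 'X_{1..m}) :
    (forall i, P i -> 0 <= c i) ->
    (forall i, P i -> (mdeg (a i) + mdeg (b i) <= d)%N) ->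
  box_cone g d (\sum_(i <- r | P i) c i *: box_product g (a i) (b i)).
Proof.
move=> c0 abd.
exists (fun a' b' => \sum_(i <- r | P i && ((a i == a') && (b i == b'))) c i).
split; first by move=> a' b' _; apply: sumr_ge0 => i /andP[/c0].
under [RHS]eq_bigr do rewrite scaler_suml.
rewrite (exchange_big_dep P) /=; last by move=> ab i _ /andP[].
apply: eq_bigr => i Pi.
have ha : (mdeg (a i) < d.+1)%N by have := abd _ Pi; lia.
have hb : (mdeg (b i) < d.+1)%N by have := abd _ Pi; lia.
rewrite (big_pred1 (BMultinom ha, BMultinom hb)) //= => -[a' b'] /=.
rewrite Pi xpair_eqE -[a' == _]val_eqE -[b' == _]val_eqE [a i == _]eq_sym [b i == _]eq_sym /=.
by apply: andb_idl => /andP[/eqP -> /eqP ->]; exact: abd.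
Qed.

(** Multipliers of larger total degree are taken to be zero. *)
Lemma box_cone_le (R : realType) (n m : nat) (g : 'I_m -> {mpoly R[n]})
    (d e : nat) : (d <= e)%N -> box_cone g d `<=` box_cone g e.
Proof.
move=> de p [lambda [l0 ->]]; apply: box_cone_sum => ab abd; first exact: l0.
exact: leq_trans abd de.
Qed.

Lemma box_cone_comp (R : realType) (n m l : nat) (g : 'I_m -> {mpoly R[n]})
    (s : n.-tuple {mpoly R[l]}) (d : nat) (p : {mpoly R[n]}) :
  box_cone g d p -> box_cone (fun j => g j \mPo s) d (p \mPo s).
Proof.
move=> [lambda [l0 ->]]; exists lambda; split => //.
rewrite raddf_sum; apply: eq_bigr => ab _ /=.
rewrite comp_mpolyZ /box_product rmorph_prod; congr (_ *: _).
by apply: eq_bigr => j _; rewrite rmorphM !rmorphXn rmorphB rmorph1.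
Qed.

Lemma box_cone_ge0 (R : realType) (n m : nat) (g : 'I_m -> {mpoly R[n]})
    (d : nat) (p : {mpoly R[n]}) (x : 'rV[R]_n) :
  (forall j, 0 <= evalv (g j) x <= 1) -> box_cone g d p -> 0 <= evalv p x.
Proof.
move=> gx [lambda [l0 ->]]; rewrite /evalv raddf_sum /=; apply: sumr_ge0 => ab abd.
rewrite mevalZ mulr_ge0 ?l0 // rmorph_prod; apply: prodr_ge0 => j _.
have /andP[g0 g1] := gx j.
by rewrite rmorphM !rmorphXn rmorphB rmorph1 mulr_ge0 ?exprn_ge0 // subr_ge0.
Qed.

(** * Polynomials on the unit cube *)

Definition unit_cube (R : realType) (m : nat) : set 'rV[R]_m :=
  [set y | forall j, 0 <= y ord0 j <= 1].

Lemma unit_cube_compact (R : realType) (m : nat) : compact (@unit_cube R m).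
Proof.
have := @rV_compact R m _ (fun=> @segment_compact R 0 1).
by congr compact; apply/seteqP; split => y /= h j; have := h j; rewrite /= in_itv.
Qed.

Lemma evalv_continuous (R : realType) (n : nat) (p : {mpoly R[n]}) :
  continuous (@evalv R n p).
Proof.
move=> x; rewrite /continuous_at /evalv mevalE.
under eq_fun do rewrite mevalE.
apply: (@cvg_big _ _ _ _ _ _ _ (nbhs x) _ _ _ (nbhs_filter x)) => [|a _]; first exact: add_continuous.
apply: cvgMr.
apply: (@cvg_big _ _ _ _ _ _ _ (nbhs x) _ _ _ (nbhs_filter x)) => [|i _]; first exact: mul_continuous.
elim: (a i) => [|e IH].
  by under eq_fun do rewrite expr0; rewrite expr0; exact: cvg_cst.
under eq_fun do rewrite exprS; rewrite exprS.
by apply: cvgM => //; exact: coord_continuous.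
Qed.

Lemma unit_cube_min (R : realType) (m : nat) (p : {mpoly R[m]}) :
  exists2 y, unit_cube y & forall z, unit_cube z -> evalv p y <= evalv p z.
Proof.
have [||y] := @EVT_min_rV R m (evalv p) (@unit_cube R m) _ (@unit_cube_compact R m).
- by exists 0 => j; rewrite mxE lexx ler01.
- exact/continuous_subspaceT/evalv_continuous.
move=> /set_mem yc ymin; exists y => // z zc; apply: ymin; exact: mem_set.
Qed.

(** The coefficient of p on the Bernstein polynomial
    prod_j 'C(N, k j) 'X_j^(k j) (1 - 'X_j)^(N - k j). *)
Definition bernstein_coef (R : realType) (m N : nat) (p : {mpoly R[m]})
    (k : {ffun 'I_m -> 'I_N.+1}) : R :=
  \sum_(a <- msupp p)
     p@_a * \prod_(j < m) ('C(k j, a j)%:R / 'C(N, a j)%:R).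

(** Expand each variable of each monomial by [bernstein_monomial] and distribute
    the product over the sums. *)
Lemma bernstein_expansion (R : realType) (m N : nat) (p : {mpoly R[m]}) :
    (forall a j, a \in msupp p -> (a j <= N)%N) ->
  p = \sum_(k : {ffun 'I_m -> 'I_N.+1})
        (bernstein_coef p k * \prod_(j < m) 'C(N, k j)%:R) *:
        box_product (fun j : 'I_m => 'X_j : {mpoly R[m]})
          [multinom k j : nat | j < m] [multinom (N - k j)%N | j < m].
Proof.
move=> pN; rewrite {1}[p]mpolyE /bernstein_coef.
under [RHS]eq_bigr do rewrite mulr_suml scaler_suml.
rewrite exchange_big /= [LHS]big_seq [RHS]big_seq; apply: eq_bigr => a ap.
rewrite mpolyXE_id.
rewrite (eq_bigr _ (fun j _ => bernstein_monomial 'X_j (pN a j ap))).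
rewrite bigA_distr_bigA /= scaler_sumr; apply: eq_bigr => k _.
rewrite scaler_prod scalerA big_split /= mulrA; congr (_ *: _).
by apply: eq_bigr => j _; rewrite !mnmE.
Qed.

Lemma bernstein_coef_approx (R : realType) (m N D : nat) (p : {mpoly R[m]})
    (k : {ffun 'I_m -> 'I_N.+1}) :
    (0 < N)%N -> (2 * D <= N)%N -> (forall a, a \in msupp p -> (mdeg a <= D)%N) ->
  `|bernstein_coef p k - evalv p (\row_j ((k j)%:R / N%:R))| <=
    (\sum_(a <- msupp p) `|p@_a|) * (D%:R * ((2 * D)%:R / N%:R)).
Proof.
move=> N0 DN pD; rewrite /evalv mevalE /bernstein_coef -sumrB mulr_suml.
apply: le_trans (ler_norm_sum _ _ _) _.
rewrite [leLHS]big_seq [leRHS]big_seq; apply: ler_sum => a ap.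
rewrite -mulrBr normrM ler_wpM2l //.
have kN j : (k j <= N)%N by rewrite -ltnS.
have x01 j : 0 <= ((k j)%:R / N%:R : R) <= 1.
  by rewrite divr_ge0 // ler_pdivrMr ?ltr0n // mul1r ler_nat kN.
apply: le_trans (norm_prod_sub_le _ _ _) _ => [j|j|].
- have /andP[? ?] := @bin_ratio_ge0_le1 R N (k j) (a j) (kN j).
  by rewrite ger0_norm.
- have /andP[? ?] := x01 j.
  by rewrite mxE ger0_norm ?exprn_ge0 // exprn_ile1.
apply: (@le_trans _ _ (\sum_(j < m) (a j)%:R * ((2 * D)%:R / N%:R))).
  apply: ler_sum => j _; rewrite mxE; apply: bin_ratio_approx => //.
  apply: leq_trans (pD _ ap); rewrite mdegE (bigD1 j) //=; exact: leq_addr.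
rewrite -mulr_suml -natr_sum -mdegE ler_wpM2r ?divr_ge0 // ler_nat; exact: pD.
Qed.

(** For N large compared with the degree, the coefficients and the inverse of the
    minimum of p on the cube, the error in [bernstein_coef_approx] is below this
    minimum, so every Bernstein coefficient is positive. *)
Lemma box_cone_pos_cube (R : realType) (m : nat) (p : {mpoly R[m]}) :
    (forall y, unit_cube y -> 0 < evalv p y) ->
  exists d, box_cone (fun j : 'I_m => 'X_j) d p.
Proof.
move=> ppos.
have [y0 y0c y0min] := unit_cube_min p.
set delta := evalv p y0 in y0min.
have delta0 : 0 < delta by exact: ppos.
pose D := msize p.
pose M : R := \sum_(a <- msupp p) `|p@_a|.
have M0 : 0 <= M by exact: sumr_ge0.
pose N := maxn (2 * D).+1 (Num.bound (M * (D%:R * (2 * D)%:R) / delta)).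
have N0 : (0 < N)%N by rewrite leq_max.
have DN : (2 * D <= N)%N by rewrite /N; lia.
have pD a : a \in msupp p -> (mdeg a <= D)%N by move=> /msize_mdeg_lt /ltnW.
have err : M * (D%:R * ((2 * D)%:R / N%:R)) < delta.
  have -> : M * (D%:R * ((2 * D)%:R / N%:R)) = M * (D%:R * (2 * D)%:R) / N%:R.
    by rewrite !mulrA.
  rewrite ltr_pdivrMr ?ltr0n // [ltRHS]mulrC -ltr_pdivrMr //.
  apply: lt_le_trans (archi_boundP _) _; first by rewrite divr_ge0 ?mulr_ge0 // ltW.
  by rewrite ler_nat leq_maxr.
(* Each of the m variables contributes k j + (N - k j) = N to the degree. *)
exists (m * N)%N; rewrite (@bernstein_expansion R m N p); last first.
  move=> a j ap; apply: leq_trans (leq_trans (pD _ ap) _); last by lia.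
  by rewrite mdegE (bigD1 j) //= leq_addr.
apply: box_cone_sum => k _.
  rewrite mulr_ge0 ?prodr_ge0 //.
  have kc : unit_cube (\row_j ((k j)%:R / N%:R) : 'rV[R]_m).
    move=> j; rewrite mxE divr_ge0 // ler_pdivrMr ?ltr0n // mul1r ler_nat.
    by rewrite -ltnS ltn_ord.
  have := bernstein_coef_approx k N0 DN pD; rewrite -/M.
  have := y0min _ kc; rewrite ler_norml => h /andP[h1 _].
  lra.
rewrite !mdegE -big_split /= (eq_bigr (fun=> N)) => [|j _].
  by rewrite sum_nat_const card_ord.
by rewrite !mnmE subnKC // -ltnS.
Qed.

(** * From the cube to semialgebraic sets *)

Lemma comp_mpolyA (R : comNzRingType) (n m l : nat) (s : n.-tuple {mpoly R[m]})
    (t : m.-tuple {mpoly R[l]}) (p : {mpoly R[n]}) :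
  (p \mPo s) \mPo t = p \mPo [tuple tnth s i \mPo t | i < n].
Proof.
rewrite (comp_mpolyE p s) [RHS]comp_mpolyE raddf_sum; apply: eq_bigr => a _ /=.
rewrite comp_mpolyZ rmorph_prod; congr (_ *: _); apply: eq_bigr => i _.
by rewrite rmorphXn tnth_mktuple.
Qed.

(** The polynomials in the [g j] form a subalgebra containing the generators, hence
    everything. *)
Lemma generates_algebra_comp (R : realType) (n m : nat)
    (g : 'I_m -> {mpoly R[n]}) :
    generates_algebra (B := {mpoly R[n]})
      ([set g j | j in [set: 'I_m]] `|` [set 1 - g j | j in [set: 'I_m]]) ->
  forall p, exists F : {mpoly R[m]}, p = F \mPo [tuple g j | j < m].
Proof.
move=> gen p; set s := [tuple g j | j < m].
pose S := fun p : {mpoly R[n]} => `[< exists F : {mpoly R[m]}, p = F \mPo s >].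
have gS j : exists F : {mpoly R[m]}, g j = F \mPo s.
  by exists 'X_j; rewrite comp_mpolyXU -tnth_nth tnth_mktuple.
apply/asboolP; apply: (gen S) => [|q [[j _ <-]|[j _ <-]]].
- split.
  + by apply/asboolP; exists 1; rewrite rmorph1.
  + move=> c u v /asboolP[U ->] /asboolP[V ->]; apply/asboolP.
    by exists (c *: U + V); rewrite comp_mpolyD comp_mpolyZ.
  + move=> u v /asboolP[U ->] /asboolP[V ->]; apply/asboolP.
    by exists (U * V); rewrite rmorphM.
- exact/asboolP.
- apply/asboolP; have [F ->] := gS j; exists (1 - F).
  by rewrite rmorphB rmorph1.
Qed.

(** On the compact set of points of K where f <= 0, the function q has a positive
    minimum, so a large multiple of q outweighs the lower bound of f; elsewhere f
    is already positive. *)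
Lemma compact_penalty (R : realType) (T : topologicalType) (K : set T)
    (f q : T -> R) :
    compact K -> continuous f -> continuous q ->
    (forall y, K y -> 0 <= q y) -> (forall y, K y -> q y = 0 -> 0 < f y) ->
  exists c, forall y, K y -> 0 < f y + c * q y.
Proof.
move=> Kc fc qc q0 fpos.
pose Z := K `&` [set y | f y <= 0].
have Zc : compact Z.
  apply: compact_closedI => //.
  apply: (@preimage_closed _ _ f [set r | r <= 0]) => [x _|]; first exact: fc.
  exact: closed_le.
have [[z Zz]|Z0] := pselect (Z !=set0); last first.
  exists 0 => y Ky; rewrite mul0r addr0 ltNge; apply/negP => fy.
  by apply: Z0; exists y.
have Z0 : Z !=set0 by exists z.
have K0 : K !=set0 by exists z; case: Zz.
have [z1 /set_mem[Kz1 fz1] qmin] := compact_EVT_min Z0 Zc (continuous_subspaceT qc).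
have [y1 _ fmin] := compact_EVT_min K0 Kc (continuous_subspaceT fc).
have qz1 : 0 < q z1.
  rewrite lt_neqAle q0 // andbT eq_sym; apply/negP => /eqP /(fpos _ Kz1).
  by rewrite ltNge fz1.
(* z1 minimises q where f <= 0, and y1 minimises f on all of K. *)
exists ((`|f y1| + 1) / q z1) => y Ky.
have c0 : 0 < (`|f y1| + 1) / q z1 by rewrite divr_gt0 // ltr_wpDl.
have [fy|fy] := ltP 0 (f y); first by rewrite ltr_wpDr // mulr_ge0 ?q0 // ltW.
have qy : q z1 <= q y by apply: qmin; apply: mem_set.
have fy1 : - `|f y1| <= f y.
  by apply: le_trans (fmin _ (mem_set Ky)); rewrite lerNl -normrN ler_norm.
have : `|f y1| + 1 <= (`|f y1| + 1) / q z1 * q y.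
  rewrite -mulrA ler_peMr ?addr_ge0 // mulrC ler_pdivlMr // mul1r //.
lra.
Qed.

(** A representation over the cube is transported along y = g(x), after adding to
    the lift F of p a multiple of a polynomial q that vanishes at g and is
    positive at the points of the cube outside g(K). *)
Lemma box_cone_pos_semialg (R : realType) (n m : nat)
    (g : 'I_m -> {mpoly R[n]}) (p : {mpoly R[n]}) :
    generates_algebra (B := {mpoly R[n]})
      ([set g j | j in [set: 'I_m]] `|` [set 1 - g j | j in [set: 'I_m]]) ->
    (forall x, semialg g x -> 0 < evalv p x) ->
  exists d, box_cone g d p.
Proof.
move=> /generates_algebra_comp gen ppos.
set s := [tuple g j | j < m] in gen.
have [F pF] := gen p.
have [h hX] := fin_all_exists (fun i : 'I_n => gen 'X_i).
pose q : {mpoly R[m]} := \sum_(j < m) ('X_j - (g j \mPo [tuple h i | i < n])) ^+ 2.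
have Xs (j : 'I_m) : 'X_j \mPo s = g j.
  by rewrite comp_mpolyXU -tnth_nth tnth_mktuple.
(* q vanishes at g because h(g) is the identity. *)
have qs : q \mPo s = 0.
  rewrite raddf_sum big1 // => j _ /=.
  have -> : ('X_j - (g j \mPo [tuple h i | i < n])) ^+ 2 \mPo s
          = ('X_j \mPo s - (g j \mPo [tuple h i | i < n] \mPo s)) ^+ 2.
    by rewrite rmorphXn rmorphB.
  rewrite Xs comp_mpolyA.
  have -> : [tuple tnth [tuple h i | i < n] i \mPo s | i < n] = [tuple 'X_i | i < n].
    by apply: eq_from_tnth => i; rewrite !tnth_mktuple hX.
  by rewrite comp_mpoly_id subrr expr0n.
have qE y : evalv q y =
    \sum_(j < m) (y ord0 j - evalv (g j) (\row_i evalv (h i) y)) ^+ 2.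
  rewrite /evalv raddf_sum; apply: eq_bigr => j _ /=.
  rewrite rmorphXn rmorphB /= mevalXU comp_mpoly_meval; congr ((_ - _) ^+ 2).
  by apply: meval_eq => i; rewrite tnth_mktuple mxE.
have qge0 y : 0 <= evalv q y by rewrite qE sumr_ge0 // => j _; exact: sqr_ge0.
(* A zero y of q in the cube is g(x) for the point x = h(y), which is in K. *)
have Fpos y : unit_cube y -> evalv q y = 0 -> 0 < evalv F y.
  move=> yc qy0; pose x : 'rV[R]_n := \row_i evalv (h i) y.
  have yx j : y ord0 j = evalv (g j) x.
    apply/eqP; rewrite -subr_eq0 -sqrf_eq0; apply/eqP.
    move/eqP: qy0; rewrite qE psumr_eq0; last by move=> i _; exact: sqr_ge0.
    by move=> /allP /(_ j (mem_index_enum _)) /= /eqP.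
  have /ppos : semialg g x by move=> j; rewrite -yx; case/andP: (yc j).
  rewrite pF /evalv comp_mpoly_meval; congr (0 < _).
  by apply: meval_eq => j; rewrite tnth_mktuple yx.
have [c Gpos] := compact_penalty (@unit_cube_compact R m) (@evalv_continuous R m F)
  (@evalv_continuous R m q) (fun y _ => qge0 y) Fpos.
have [d] : exists d, box_cone (fun j : 'I_m => 'X_j) d (F + c *: q).
  by apply: box_cone_pos_cube => y /Gpos; rewrite /evalv mevalD mevalZ.
move=> /(box_cone_comp s); rewrite comp_mpolyD comp_mpolyZ qs scaler0 addr0 -pF.
by under eq_fun do rewrite Xs; exists d.
Qed.

(** * The Lagrange bounds *)

Lemma sos_sonc_cone_ge0 (R : realType) (n k : nat) (p : {mpoly R[n]}) :
  sos_sonc_cone k p -> forall x, 0 <= evalv p x.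
Proof.
move=> [s [c [[rs [_ ->]] [[rc [rcP ->]] _] ->]]] x.
rewrite /evalv mevalD !raddf_sum /= addr_ge0 //.
  by apply: sumr_ge0 => q _; rewrite rmorphXn sqr_ge0.
rewrite big_seq; apply: sumr_ge0 => t /rcP[t0 _ tx].
by rewrite mevalZ mulr_ge0 //; exact: tx.
Qed.

Lemma sos_sonc_cone_supp0 (R : realType) (n k : nat) (A : {fset 'X_{1..n}}) :
  sos_sonc_cone_supp k A (0 : {mpoly R[n]}).
Proof.
split; last by move=> a; rewrite msupp0.
exists 0, 0; split; last by rewrite addr0.
- by exists [::]; rewrite big_nil.
- by split; [exists [::]; rewrite big_nil | rewrite /deg_le msize0].
Qed.

(** The multipliers enter the bound only through the element of the box cone that
    they define. *)
Lemma lagrange_boundE (R : realType) (n m : nat) (f : {mpoly R[n]})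
    (g : 'I_m -> {mpoly R[n]}) (A : {fset 'X_{1..n}}) (k d : nat) :
  lagrange_bound f g A k d = ereal_sup [set t%:E | t in
    [set t : R | exists2 p, box_cone g d p &
                   sos_sonc_cone_supp k A (f - p - t%:MP)]].
Proof.
congr ereal_sup; congr image; apply/seteqP; split => t /=.
  by move=> [lambda [l0 h]]; exists (f - Defs.lagrange f g d lambda);
     [exists lambda; rewrite /Defs.lagrange subKr | rewrite subKr].
by move=> [p [lambda [l0 ->]] h]; exists lambda.
Qed.

Lemma le_lagrange_bound (R : realType) (n m : nat) (f : {mpoly R[n]})
    (g : 'I_m -> {mpoly R[n]}) (A : {fset 'X_{1..n}}) (k d e : nat) :
  (d <= e)%N -> (lagrange_bound f g A k d <= lagrange_bound f g A k e)%E.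
Proof.
move=> de; rewrite !lagrange_boundE; apply: ereal_sup_le.
apply: image_subset => t [p /(box_cone_le de) pe h]; by exists p.
Qed.

Lemma lagrange_bound_le_min (R : realType) (n m : nat) (f : {mpoly R[n]})
    (g : 'I_m -> {mpoly R[n]}) (A : {fset 'X_{1..n}}) (k d : nat) :
    (forall x j, semialg g x -> 0 <= evalv (g j) x <= 1) ->
  (lagrange_bound f g A k d <= min_value f (semialg g))%E.
Proof.
move=> gb; rewrite lagrange_boundE.
apply: ge_ereal_sup => _ [t [p pd [/sos_sonc_cone_ge0 h _]] <-].
apply: le_ereal_inf_tmp => _ [x Kx <-]; rewrite lee_fin.
have := box_cone_ge0 (fun j => gb x j Kx) pd.
by have := h x; rewrite /evalv !mevalB mevalC; lra.
Qed.

(** The zero polynomial is the certificate: f - t itself lies in a box cone. *)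
Lemma min_value_approx (R : realType) (n m : nat) (f : {mpoly R[n]})
    (g : 'I_m -> {mpoly R[n]}) (A : {fset 'X_{1..n}}) (k : nat) (t : R) :
    generates_algebra (B := {mpoly R[n]})
      ([set g j | j in [set: 'I_m]] `|` [set 1 - g j | j in [set: 'I_m]]) ->
    (t%:E < min_value f (semialg g))%E ->
  exists d, (t%:E <= lagrange_bound f g A k d)%E.
Proof.
move=> gen tf.
have [x Kx|d pd] := @box_cone_pos_semialg R n m g (f - t%:MP) gen.
  have : (t%:E < (evalv f x)%:E)%E.
    by apply: lt_le_trans tf _; apply: ereal_inf_lbound; exists x.
  by rewrite lte_fin /evalv mevalB mevalC subr_gt0.
exists d; rewrite lagrange_boundE; apply: ereal_sup_ubound; exists t => //.
by exists (f - t%:MP) => //; rewrite subKr subrr; exact: sos_sonc_cone_supp0.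
Qed.

Unset Implicit Arguments.
Set Strict Implicit.

Theorem theorem3p2 (R : realType) (n m : nat) (f : {mpoly R[n]})
    (g : 'I_m -> {mpoly R[n]}) (A : {fset 'X_{1..n}})
    (K_nonempty : semialg g !=set0)
    (K_compact : compact (semialg g))
    (g_bounded : forall x j, semialg g x -> 0 <= evalv (g j) x <= 1)
    (g_generates : generates_algebra (B := {mpoly R[n]})
       ([set g j | j in [set: 'I_m]] `|` [set 1 - g j | j in [set: 'I_m]]))
    (k : nat) :
  {homo lagrange_bound f g A k : d e / (d <= e)%N >-> (d <= e)%E} /\
  lagrange_bound f g A k @ \oo --> min_value f (semialg g).
Proof.
have mono : {homo lagrange_bound f g A k : d e / (d <= e)%N >-> (d <= e)%E}.
  by move=> d e; exact: le_lagrange_bound.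
split=> //.
suff -> : min_value f (semialg g) = ereal_sup (range (lagrange_bound f g A k)).
  exact: ereal_nondecreasing_cvgn.
apply/eqP; rewrite eq_le; apply/andP; split; last first.
  by apply: ge_ereal_sup => _ [d _ <-]; exact: lagrange_bound_le_min.
have [x Kx] := K_nonempty.
have min_lt : (min_value f (semialg g) < +oo)%E.
  apply: (@le_lt_trans _ _ (evalv f x)%:E); last exact: ltry.
  by apply: ereal_inf_lbound; exists x.
rewrite leNgt; apply/negP => sup_lt.
have [t st tf] : exists2 t : R, (ereal_sup (range (lagrange_bound f g A k)) < t%:E)%E
    & (t%:E < min_value f (semialg g))%E.
  move: sup_lt min_lt.
  case: (ereal_sup _) => [s| |]; case: (min_value _ _) => [r| |] //= + _.
  - by rewrite lte_fin => sr; exists ((s + r) / 2); rewrite lte_fin; lra.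
  - by move=> _; exists (r - 1); rewrite ?ltNyr // lte_fin; lra.
have [d td] := min_value_approx A k g_generates tf.
move: st; rewrite ltNge => /negP; apply.
by apply: le_trans td _; apply: ereal_sup_ubound; exists d.
Qed.
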